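(* Assume that $Y=(Y_j)_{j\in\mathbb{N}}$ are observations from the Gaussian sequence model $Y_j=b_j\theta_j+\varepsilon\xi_j$, $j\in\mathbb{N}$, and consider the signal detection problem $H_0:\theta=0$ versus $H_1:\theta\in\Theta_a(r_\varepsilon)$, where $\Theta_a(r_\varepsilon)=\{\theta\in\mathcal{E}_a:\ \|\theta\|\ge r_\varepsilon\}$. Assume that both sequences $a=(a_j)_{j\in\mathbb{N}}$ and $b^{-1}=(b_j^{-1})_{j\in\mathbb{N}}$ are non-decreasing and that they satisfy $$a_\star\le\frac{a_{D-1}}{a_D}\le a^\star\quad\text{and}\quad b_\star\le\frac{b_{D-1}}{b_D}\le b^\star\qquad\text{for all }D>1,$$ for some constants $0<a_\star\le a^\star<\infty$ and $0<b_\star\le b^\star<\infty$. Let $\alpha,\beta\in\,]0,1[$ be given. Then there exists a constant $C\ge1$ such that $$\inf_{D\in\mathbb{N}}\left[C(\alpha,\beta)\,\varepsilon^2\sqrt{\textstyle\sum_{j=1}^Db_j^{-4}}+a_D^{-2}\right]\;\le\;C\,\sup_{D\in\mathbb{N}}\left[\Big(c(\alpha,\beta)\,\varepsilon^2\sqrt{\textstyle\sum_{j=1}^Db_j^{-4}}\Big)\wedge a_D^{-2}\right],$$ where $$c(\alpha,\beta)=\big(2\ln(1+4(1-\alpha-\beta)^2)\big)^{1/4},$$ $$C(\alpha,\beta)=\sqrt{2x_\beta}+\sqrt{2(x_\alpha+x_\beta)}+\sqrt2\,\big(\sqrt{x_\alpha}+\sqrt{x_\beta}\big)^{1/2},\qquad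 x_\gamma:=\ln(1/\gamma)\ \text{ for }\gamma\in\,]0,1[.$$ In particular, the lower and upper bounds in the control $$\sup_{D\in\mathbb{N}}\left[\Big(c(\alpha,\beta)\,\varepsilon^2\sqrt{\textstyle\sum_{j=1}^D b_j^{-4}}\Big)\wedge a_D^{-2}\right]\;\le\;\tilde r_\varepsilon^2\;\le\;\inf_{D\in\mathbb{N}}\left[C(\alpha,\beta)\,\varepsilon^2\sqrt{\textstyle\sum_{j=1}^D b_j^{-4}}+a_D^{-2}\right]$$ of the minimax separation radius $\tilde r_\varepsilon$ are of the same order.
   Context: $\mathbb{N}=\{1,2,\ldots\}$ and $x\wedge y=\inf\{x,y\}$. Gaussian sequence model: one observes $Y=(Y_j)_{j\in\mathbb{N}}$ with $Y_j=b_j\theta_j+\varepsilon\xi_j$, where $b=(b_j)_{j\in\mathbb{N}}$ is a known sequence of positive reals, $\varepsilon>0$ is the known noise level, $\theta\in l^2(\mathbb{N})$ is unknown, and the $\xi_j$ are independent standard Gaussian variables. $\mathbb{P}_\theta$ denotes the law of $Y$, and $\|\theta\|^2=\sum_{j\in\mathbb{N}}\theta_j^2$. $a=(a_j)_{j\in\mathbb{N}}$ is a non-decreasing sequence of positive reals with $a_j\to+\infty$ as $j\to+\infty$; $\mathcal{E}_a=\{\theta\in l^2(\mathbb{N}):\sum_{j\in\mathbb{N}}a_j^2\theta_j^2\le1\}$; and, for $r>0$, $\Theta_a(r)=\{\theta\in\mathcal{E}_a:\|\theta\|\ge r\}$. A test is a measurable function $\Psi=\Psi(Y)$ with values in $\{0,1\}$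 ($H_0$ is rejected iff $\Psi=1$); it is an $\alpha$-level test if $\mathbb{P}_0(\Psi=1)\le\alpha$. The minimax separation radius over $\mathcal{E}_a$ is $\tilde r_\varepsilon=\inf_{\Psi}\inf\{r>0:\sup_{\theta\in\Theta_a(r)}\mathbb{P}_\theta(\Psi=0)\le\beta\}$, the first infimum being over all $\alpha$-level tests $\Psi$.
   Formalization: The case α+β=1 is excluded: there c(α,β)=0, so the supremum is 0 while the infimum is positive and the inequality fails for every C; the constant C is uniform over 0<ε≤ε₀ for any given ε₀, and the quoted control of the separation radius is not itself proved. *)

(* Defs.v *)
From HB Require Import structures.
From mathcomp Require Import all_boot all_order all_algebra.
From mathcomp Require Import all_classical all_reals all_analysis.

Set Implicit Arguments.
Unset Strict Implicit.
Unset Printing Implicit Defensive.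

Import Order.TTheory GRing.Theory Num.Theory.
Import numFieldNormedType.Exports.

Local Open Scope classical_set_scope.
Local Open Scope ring_scope.

(* Sequences indexed by {1, 2, ...} are functions on [nat] shifted by one:
   [u j] is the term of index j + 1. Likewise a dimension D >= 1 is given by
   the natural number D - 1, whence the sums over [j < D.+1] below. *)

Section sequence_model.
Context {R : realType}.

Definition square_summable (theta : nat -> R) : Prop :=
  cvgn (series (fun j => theta j ^+ 2)).

Definition l2norm (theta : nat -> R) : R :=
  Num.sqrt (limn (series (fun j => theta j ^+ 2))).

Definition ellipsoid (a : nat -> R) : set (nat -> R) :=
  [set theta | square_summable theta /\
     (\sum_(0 <= j <oo) (a j ^+ 2 * theta j ^+ 2)%:E <= 1)%E].

Definition alternative (a : nat -> R) (r : R) : set (nat -> R) :=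
  [set theta | ellipsoid a theta /\ r <= l2norm theta].

(* The product sigma-algebra of [nat -> R] is generated by these sets. *)
Definition coordinate_cylinders : set (set (nat -> R)) :=
  \bigcup_j preimage_set_system setT (fun y : nat -> R => y j) measurable.

Definition is_test (Psi : (nat -> R) -> bool) : Prop :=
  measurable_fun [set: g_sigma_algebraType coordinate_cylinders]
    (Psi : g_sigma_algebraType coordinate_cylinders -> bool).

Section noise.
Context {d : measure_display} {T : measurableType d} (P : probability T R).

Definition mutually_independent (xi : nat -> {RV P >-> R}) : Prop :=
  forall (J : seq nat) (A : nat -> set R),
    uniq J -> (forall j, measurable (A j)) ->
    P (\bigcap_(j in [set` J]) (xi j @^-1` A j)) =
    (\prod_(j <- J) P (xi j @^-1` A j))%E.

Definition gaussian_noise (xi : nat -> {RV P >-> R}) : Prop :=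
  mutually_independent xi /\
  forall (j : nat) (A : set R), measurable A ->
    distribution P (xi j) A = normal_prob 0 1 A.

Variables (b : nat -> R) (eps : R) (xi : nat -> {RV P >-> R}).

Definition observation (theta : nat -> R) (omega : T) : nat -> R :=
  fun j => b j * theta j + eps * xi j omega.

Definition obs_law (theta : nat -> R) (A : set (nat -> R)) : \bar R :=
  P (observation theta @^-1` A).

Definition level_test (alpha : R) : set ((nat -> R) -> bool) :=
  [set Psi | is_test Psi /\
     (obs_law (fun=> 0%R) [set y | Psi y = true] <= alpha%:E)%E].

(* Radii r at which the second kind error of Psi is at most beta, uniformly
   over [alternative a r]. For r > 1 / a 0 the alternative is empty and the
   supremum is -oo, so the set is nonempty and the real-valued infima in
   [separation_radius] are genuine. *)
Definition separating_radii (a : nat -> R) (beta : R)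
    (Psi : (nat -> R) -> bool) : set R :=
  [set r | 0 < r /\
     (ereal_sup [set obs_law theta [set y | Psi y = false]
                | theta in alternative a r] <= beta%:E)%E].

Definition separation_radius (a : nat -> R) (alpha beta : R) : R :=
  inf [set inf (separating_radii a beta Psi) | Psi in level_test alpha].

End noise.

Definition c_low (alpha beta : R) : R :=
  (2 * ln (1 + 4 * (1 - alpha - beta) ^+ 2)) `^ (4^-1).

Definition x_ (gamma : R) : R := ln (1 / gamma).

Definition C_up (alpha beta : R) : R :=
  Num.sqrt (2 * x_ beta) + Num.sqrt (2 * (x_ alpha + x_ beta)) +
  Num.sqrt 2 * Num.sqrt (Num.sqrt (x_ alpha) + Num.sqrt (x_ beta)).

Definition noise_scale (b : nat -> R) (D : nat) : R :=
  Num.sqrt (\sum_(j < D.+1) b j ^- 4).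

Definition lower_bound (a b : nat -> R) (alpha beta eps : R) : R :=
  sup (range (fun D : nat =>
    Num.min (c_low alpha beta * eps ^+ 2 * noise_scale b D) (a D ^- 2))).

Definition upper_bound (a b : nat -> R) (alpha beta eps : R) : R :=
  inf (range (fun D : nat =>
    C_up alpha beta * eps ^+ 2 * noise_scale b D + a D ^- 2)).

End sequence_model.

(* Main.v *)
Require Import Defs.
From HB Require Import structures.
From mathcomp Require Import all_boot all_order all_algebra.
From mathcomp Require Import all_classical all_reals all_analysis.
From mathcomp Require Import ring lra.

Import Order.TTheory GRing.Theory Num.Theory.
Import numFieldNormedType.Exports.

Local Open Scope classical_set_scope.
Local Open Scope ring_scope.

(** Write [s D] for [noise_scale b D], which is non-decreasing, and [v D] for
    [a D ^- 2], which is non-increasing and tends to [0]. Set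
    [k := c(alpha, beta) * eps ^ 2] and [l := C(alpha, beta) * eps ^ 2]; both
    are positive, the first because [alpha + beta != 1]. The statement compares
    the best trade-off [inf_D (l * s D + v D)] with the crossing level
    [sup_D (min (k * s D) (v D))] of the two sequences.

    Let [D] be the first dimension at which [v D < k * s D]. If [D = E + 1],
    then [k * s E <= v E], so the supremum is at least [k * s E], whereas the
    infimum is at most [l * s D + v D <= (l / k + 1) * (k * s D)]. As [1 / b]
    grows at most geometrically, [s (E + 1) <= M * s E] with
    [M := sqrt (1 + b_hi ^ 4)], which gives the bound
    ([inf_add_le_sup_min]). If [D = 0], the supremum is at least [v 0], and the
    infimum is at most [l * s 0 + v 0]; this is where the upper bound [eps0] on
    the noise level enters. The ratio [l / k] does not depend on [eps], so the
    constant is uniform.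

    The converse inequality holds because [min (k * s D) (v D)] is bounded by a
    multiple of [l * s D' + v D'] for all [D] and [D'], by monotonicity of [s]
    if [D <= D'] and of [v] otherwise ([sup_min_le_inf_add]). The comparison
    with the separation radius then follows from its two bounds. *)

Section tradeoff.
Context {R : realType}.
Variables s v : nat -> R.
Hypotheses (s_gt0 : forall D, 0 < s D) (v_gt0 : forall D, 0 < v D).

Lemma has_inf_add (l : R) : 0 < l ->
  has_inf (range (fun D => l * s D + v D)).
Proof.
move=> l0; split; first by exists (l * s 0%N + v 0%N), 0%N.
by exists 0 => _ [D _ <-]; rewrite addr_ge0 ?mulr_ge0 // ltW.
Qed.

Lemma inf_add_ge0 (l : R) : 0 < l ->
  0 <= inf (range (fun D => l * s D + v D)).
Proof.
move=> l0; apply: lb_le_inf; first exact: (has_inf_add _ l0).1.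
by move=> _ [D _ <-]; rewrite addr_ge0 ?mulr_ge0 // ltW.
Qed.

Hypothesis v_ni : {homo v : m n / (m <= n)%N >-> n <= m}.

Lemma has_sup_min (k : R) : has_sup (range (fun D => Num.min (k * s D) (v D))).
Proof.
split; first by exists (Num.min (k * s 0%N) (v 0%N)), 0%N.
by exists (v 0%N) => _ [D _ <-]; rewrite ge_min v_ni // orbT.
Qed.

Lemma sup_min_ge0 (k : R) : 0 < k ->
  0 <= sup (range (fun D => Num.min (k * s D) (v D))).
Proof.
move=> k0; apply: le_trans (ub_le_sup (has_sup_min k).2 (imageT _ 0%N)).
by rewrite le_min !ltW ?mulr_gt0.
Qed.

Lemma sup_min_le_inf_add (k l : R) : 0 < k -> 0 < l ->
    {homo s : m n / (m <= n)%N >-> m <= n} ->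
  sup (range (fun D => Num.min (k * s D) (v D))) <=
  (1 + k / l) * inf (range (fun D => l * s D + v D)).
Proof.
move=> k0 l0 s_nd; have kl0 : 0 < k / l by rewrite divr_gt0.
have kl1 : 0 < 1 + k / l by rewrite addr_gt0.
apply: ge_sup; first exact: (has_sup_min k).1.
move=> _ [D _ <-]; rewrite [leRHS]mulrC -ler_pdivrMr//.
apply: lb_le_inf; first exact: (has_inf_add _ l0).1.
move=> _ [D' _ <-]; rewrite ler_pdivrMr//.
have v0 := ltW (v_gt0 D'); have ls0 : 0 <= l * s D' by rewrite mulr_ge0 ?ltW.
rewrite mulrDr mulr1 ge_min; have [DD'|D'D] := leqP D D'.
  apply/orP; left.
  have -> : (l * s D' + v D') * (k / l) = k * s D' + v D' * (k / l).
    by field; rewrite gt_eqF.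
  apply: (@le_trans _ _ (k * s D')); first by rewrite ler_pM2l// s_nd.
  by rewrite addrCA lerDl !addr_ge0// mulr_ge0// ltW.
apply/orP; right; apply: le_trans (v_ni _ _ (ltnW D'D)) _.
by rewrite -addrA addrCA lerDl addr_ge0// mulr_ge0 ?addr_ge0// ltW.
Qed.

(** In the constant, [l * s 0 / v 0] accounts for the case where the crossing
    [v D < k * s D] already occurs at [D = 0], and [(l / k + 1) * M] for a later
    crossing. *)
Lemma inf_add_le_sup_min (k l M : R) : 0 < k -> 0 < l -> 0 < M ->
    {homo s : m n / (m <= n)%N >-> m <= n} ->
    (forall D, s D.+1 <= M * s D) -> v @ \oo --> (0 : R) ->
  inf (range (fun D => l * s D + v D)) <=
  (1 + l * s 0%N / v 0%N + (l / k + 1) * M) *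
  sup (range (fun D => Num.min (k * s D) (v D))).
Proof.
move=> k0 l0 M0 s_nd s_grow v_cvg0.
set I := inf _; set S := sup _.
have S0 : 0 <= S by exact: sup_min_ge0.
have leI D : I <= l * s D + v D.
  by apply: ge_inf; [exact: (has_inf_add _ l0).2|exists D].
have leS D : Num.min (k * s D) (v D) <= S.
  by apply: ub_le_sup; [exact: (has_sup_min k).2|exists D].
have lk0 : 0 < l / k by rewrite divr_gt0.
have lsv0 : 0 < l * s 0%N / v 0%N by rewrite divr_gt0 ?mulr_gt0.
have crossing : exists D, v D < k * s D.
  have ks0 : 0 < k * s 0%N by rewrite mulr_gt0.
  have [N _ vN] := cvgr_lt _ v_cvg0 _ ks0.
  exists N; apply: lt_le_trans (vN N (leqnn N)) _.
  by rewrite ler_pM2l// s_nd.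
(* In the first case the crossing is at dimension [0]; otherwise [E] is the last
   dimension before it, by [Dmin]. *)
case: (ex_minnP crossing) => -[|E] vlt Dmin.
  have vS : v 0%N <= S by apply: le_trans (leS 0%N); rewrite le_min (ltW vlt) lexx.
  apply: le_trans (leI 0%N) _.
  have -> : l * s 0%N + v 0%N = (1 + l * s 0%N / v 0%N) * v 0%N.
    by field; rewrite gt_eqF.
  apply: ler_pM => //; [by rewrite addr_ge0// ltW|exact: ltW|].
  by rewrite lerDl mulr_ge0 ?addr_ge0// ltW.
have sS : k * s E <= S.
  apply: le_trans (leS E); rewrite le_min lexx /= leNgt; apply/negP => /Dmin.
  by rewrite ltnn.
apply: le_trans (leI E.+1) _.
apply: (@le_trans _ _ ((l / k + 1) * (k * s E.+1))).
  rewrite mulrDl mul1r; apply: lerD; last exact: ltW.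
  by rewrite le_eqVlt; apply/orP; left; apply/eqP; field; rewrite gt_eqF.
apply: (@le_trans _ _ ((l / k + 1) * M * S)).
  rewrite -mulrA ler_pM2l ?addr_gt0//.
  apply: (@le_trans _ _ (M * (k * s E))); last by rewrite ler_pM2l.
  by rewrite mulrCA ler_pM2l.
by rewrite ler_wpM2r// lerDr addr_ge0// ltW.
Qed.

End tradeoff.

Section constants.
Context {R : realType}.
Implicit Types alpha beta gamma : R.

Lemma c_low_gt0 alpha beta : alpha + beta != 1 -> 0 < c_low alpha beta.
Proof.
move=> ab; rewrite /c_low powR_gt0// mulr_gt0// ln_gt0// ltrDl mulr_gt0//.
by rewrite exprn_even_gt0//= -addrA -opprD subr_eq0 eq_sym.
Qed.

Lemma x_gt0 gamma : 0 < gamma < 1 -> 0 < x_ gamma.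
Proof. by case/andP=> g0 g1; rewrite /x_ ln_gt0// div1r invf_gt1. Qed.

Lemma C_up_gt0 alpha beta : 0 < beta < 1 -> 0 < C_up alpha beta.
Proof.
by move=> b01; rewrite /C_up -addrA ltr_pwDl ?sqrtr_gt0 ?mulr_gt0 ?x_gt0 ?addr_ge0.
Qed.

End constants.

Section noise_scale.
Context {R : realType}.
Variable b : nat -> R.
Hypothesis b_gt0 : forall j, 0 < b j.

Lemma noise_scale_nd : {homo noise_scale b : m n / (m <= n)%N >-> m <= n}.
Proof.
apply: homo_leq => [D|y x z|D]; [exact: lexx|exact: le_trans|].
rewrite /noise_scale ler_wsqrtr// [leRHS]big_ord_recr/= lerDl.
by rewrite invr_ge0 exprn_ge0// ltW.
Qed.

Lemma noise_scale_gt0 D : 0 < noise_scale b D.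
Proof.
rewrite sqrtr_gt0 big_ord_recr/= ltr_wpDl ?invr_gt0 ?exprn_gt0//.
by apply: sumr_ge0 => i _; rewrite invr_ge0 exprn_ge0// ltW.
Qed.

Lemma noise_scale_growth (h : R) : (forall D, b D / b D.+1 <= h) ->
  forall D, noise_scale b D.+1 <= Num.sqrt (1 + h ^+ 4) * noise_scale b D.
Proof.
move=> bh D.
have h4 : 0 <= h ^+ 4 by rewrite exprn_even_ge0.
rewrite /noise_scale -sqrtrM ?addr_ge0// ler_wsqrtr//.
rewrite [X in X <= _]big_ord_recr/= mulrDl mul1r lerD2l.
apply: (@le_trans _ _ (h ^+ 4 * b D ^- 4)).
  rewrite -ler_pdivrMr ?invr_gt0 ?exprn_gt0// invrK mulrC -expr_div_n.
  rewrite lerXn2r ?nnegrE ?bh ?divr_ge0 ?ltW//.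
  by rewrite (lt_le_trans _ (bh D))// divr_gt0.
rewrite ler_wpM2l// big_ord_recr/= lerDr.
by apply: sumr_ge0 => i _; rewrite invr_ge0 exprn_ge0// ltW.
Qed.

End noise_scale.

Theorem proposition4p1 (R : realType) (a b : nat -> R)
    (a_lo a_hi b_lo b_hi alpha beta : R)
    (a_gt0 : forall j, 0 < a j) (b_gt0 : forall j, 0 < b j)
    (a_nd : nondecreasing_seq a)
    (a_infty : a j @[j --> \oo] --> +oo)
    (binv_nd : nondecreasing_seq (fun j => (b j)^-1))
    (a_const : 0 < a_lo <= a_hi) (b_const : 0 < b_lo <= b_hi)
    (a_ratio : forall D, a_lo <= a D / a D.+1 <= a_hi)
    (b_ratio : forall D, b_lo <= b D / b D.+1 <= b_hi)
    (alpha01 : 0 < alpha < 1) (beta01 : 0 < beta < 1)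
    (alphabeta : alpha + beta != 1) (eps0 : R) (eps0_gt0 : 0 < eps0) :
  exists C : R, 1 <= C /\
    forall eps : R, 0 < eps <= eps0 ->
      let lo := lower_bound a b alpha beta eps in
      let up := upper_bound a b alpha beta eps in
      [/\ up <= C * lo,
          lo <= C * up &
          forall (d : measure_display) (T : measurableType d)
            (P : probability T R) (xi : nat -> {RV P >-> R}),
            gaussian_noise xi ->
            let rt2 := separation_radius b eps xi a alpha beta ^+ 2 in
            lo <= rt2 <= up ->
            up <= C * rt2 /\ rt2 <= C * lo].
Proof.
have c0 := c_low_gt0 _ _ alphabeta.
have K0 := C_up_gt0 alpha _ beta01.
set c := c_low alpha beta in c0; set K := C_up alpha beta in K0.
pose s := noise_scale b; pose v D := a D ^- 2.
have s0 D : 0 < s D by exact: noise_scale_gt0.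
have v0 D : 0 < v D by rewrite invr_gt0 exprn_gt0.
have s_nd : {homo s : m n / (m <= n)%N >-> m <= n} by exact: noise_scale_nd.
have v_ni : {homo v : m n / (m <= n)%N >-> n <= m}.
  move=> m n mn; rewrite lef_pV2 ?posrE ?exprn_gt0//.
  by rewrite lerXn2r ?nnegrE ?(ltW (a_gt0 _)) ?a_nd.
have v_cvg0 : v @ \oo --> (0 : R).
  have ai : (fun j => (a j)^-1) @ \oo --> (0 : R).
    by apply/gtr0_cvgV0 => //; exact: nearW.
  rewrite (_ : v = fun j => (a j)^-1 * (a j)^-1); last first.
    by apply/funext => j; rewrite /v expr2 invfM.
  by have := cvgM ai ai; rewrite mulr0; apply; exact: _.
pose M := Num.sqrt (1 + b_hi ^+ 4).
have M0 : 0 < M by rewrite sqrtr_gt0 ltr_wpDr// exprn_even_ge0.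
have s_grow D : s D.+1 <= M * s D.
  by apply: noise_scale_growth => // E; case/andP: (b_ratio E).
(* [C1] bounds [K * eps ^+ 2 * s 0 / v 0] uniformly in [eps <= eps0]. The
   summand [c / K] serves the converse inequality. *)
pose C1 := K * eps0 ^+ 2 * s 0%N / v 0%N.
pose C2 := (K / c + 1) * M.
have C10 : 0 < C1 by rewrite !(mulr_gt0, invr_gt0, exprn_gt0).
have C20 : 0 < C2 by rewrite mulr_gt0// addr_gt0// divr_gt0.
have cK0 : 0 < c / K by rewrite divr_gt0.
exists (1 + C1 + C2 + c / K); split.
  by rewrite -!addrA lerDl !addr_ge0// ltW.
move=> eps /andP[e0 e1] lo up.
have e2 : 0 < eps ^+ 2 by rewrite exprn_gt0.
have k0 : 0 < c * eps ^+ 2 by rewrite mulr_gt0.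
have l0 : 0 < K * eps ^+ 2 by rewrite mulr_gt0.
have lo0 : 0 <= lo by exact: sup_min_ge0.
have up0 : 0 <= up by exact: inf_add_ge0.
have up_lo : up <= (1 + C1 + C2 + c / K) * lo.
  have := inf_add_le_sup_min s v s0 v0 v_ni _ _ _ k0 l0 M0 s_nd s_grow v_cvg0.
  move=> /le_trans; apply; apply: ler_wpM2r => //.
  rewrite -mulf_div divff ?gt_eqF// mulr1 -/C2.
  have : K * eps ^+ 2 * s 0%N / v 0%N <= C1.
    apply: ler_wpM2r; first by rewrite invr_ge0 ltW.
    apply: ler_wpM2r; first exact: ltW.
    rewrite ler_pM2l//.
    by rewrite lerXn2r ?nnegrE ?(ltW e0) ?(ltW eps0_gt0).
  by move: C10 C20 cK0; lra.
have lo_up : lo <= (1 + C1 + C2 + c / K) * up.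
  have := sup_min_le_inf_add s v s0 v0 v_ni _ _ k0 l0 s_nd.
  move=> /le_trans; apply; apply: ler_wpM2r => //.
  rewrite -mulf_div divff ?gt_eqF// mulr1.
  by move: C10 C20 cK0; lra.
split => // d T P xi _ rt2 /andP[lo_rt rt_up]; split.
  apply: le_trans up_lo _; rewrite ler_wpM2l//.
  by move: C10 C20 cK0; lra.
exact: le_trans rt_up up_lo.
Qed.
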